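(* Let $V_1,V_2,\dots$ be an infinite exchangeable sequence of Bernoulli random variables whose mixture distribution function is denoted by $F$. Suppose $F$ has a density $f$ on $[0,1]$ that is Lipschitz in a neighborhood of $1/2$. Let $M_t:=1\{\frac1t\sum_{i=1}^tV_i\ge\frac12\}$ be the running majority vote. Then, as $t\to\infty$ along odd integers, $$1-\mathbb{E}[M_t]=F(\tfrac12)+\mathcal{O}\big(\tfrac1t\big).$$ Furthermore, if $f$ is also differentiable at $1/2$, then, as $t\to\infty$ along odd integers, $$1-\mathbb{E}[M_t]=F(\tfrac12)+\frac{1}{8t}f'(\tfrac12)+o\big(\tfrac1t\big).$$
   Context: An infinite sequence $V_1,V_2,\dots$ is exchangeable if the joint distribution of any finite sub-collection is invariant under permutation. By de Finetti's theorem, a sequence of Bernoulli variables is exchangeable if and only if there is a random variable $\Theta$ in $[0,1]$ such that, conditionally on $\Theta=\vartheta$, the variables $V_1,V_2,\dots$ are i.i.d. Bernoulli$(\vartheta)$; the distribution of $\Theta$ is called the mixture distribution of the sequence, and $F$ denotes its distribution function. A function $q:[0,1]\to\mathbb{R}$ is Lipschitz in a neighborhood of $1/2$ if there are constants $\kappa,\delta>0$ with $|q(s)-q(s')|\le\kappa|s-s'|$ for all $s,s'\in[1/2-\delta,1/2+\delta]$. *)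

(* Defs.v *)
From HB Require Import structures.
From mathcomp Require Import all_boot all_order all_algebra all_fingroup finmap.
From mathcomp Require Import all_classical all_reals all_analysis.

Set Implicit Arguments.
Unset Strict Implicit.
Unset Printing Implicit Defensive.

Import Order.TTheory GRing.Theory Num.Theory.
Import numFieldNormedType.Exports.

Local Open Scope classical_set_scope.
Local Open Scope ring_scope.

(* Bernoulli variables are random variables with values in [bool], [true]
   standing for 1; the sequence V_1, V_2, ... is indexed from 0. *)

Definition exchangeable (R : realType) (d : measure_display)
    (T : measurableType d) (P : probability T R) (V : nat -> {RV P >-> bool}) :=
  forall (n : nat) (i : 'I_n -> nat) (s : {perm 'I_n}), injective i ->
  forall A : set (n.-tuple bool),
    P ((fun w => [tuple V (i k) w | k < n]) @^-1` A) =
    P ((fun w => [tuple V (i (s k)) w | k < n]) @^-1` A).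

(* [g] is a version of x |-> P(A | X = x). *)
Definition is_cond_prob (R : realType) (d : measure_display)
    (T : measurableType d) (P : probability T R) (X : {RV P >-> R})
    (A : set T) (g : R -> R) :=
  measurable_fun [set: R] g /\
  forall B : set R, measurable B ->
    P (A `&` X @^-1` B) = (\int[distribution P X]_(x in B) (g x)%:E)%E.

(* Conditionally on Theta = x, the V_i are i.i.d. Bernoulli(x): the conditional
   law of every finite subfamily is the product of Bernoulli(x) laws. *)
Definition cond_iid_bernoulli (R : realType) (d : measure_display)
    (T : measurableType d) (P : probability T R) (V : nat -> {RV P >-> bool})
    (Theta : {RV P >-> R}) :=
  forall (J : {fset nat}) (v : nat -> bool),
    is_cond_prob Theta (\bigcap_(i in [set` J]) (V i @^-1` [set v i]))
      (fun x => \prod_(i <- J) bernoulli_pmf x (v i)).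

(* Asking for Theta on the same probability space as V loses no generality:
   de Finetti's theorem provides the limsup of the empirical means. *)
Definition is_mixture_cdf (R : realType) (d : measure_display)
    (T : measurableType d) (P : probability T R) (V : nat -> {RV P >-> bool})
    (F : R -> R) :=
  exists Theta : {RV P >-> R},
    [/\ forall w, 0 <= Theta w <= 1,
        cond_iid_bernoulli V Theta
      & forall x, (F x)%:E = cdf Theta x].

(* There is no condition on [f] outside [0, 1]. *)
Definition has_density01 (R : realType) (F f : R -> R) :=
  [/\ measurable_fun (`[0, 1] : set R) f,
      forall x, x \in `[0, 1] -> 0 <= f x
    & forall x, x \in `[0, 1] ->
        (F x)%:E = (\int[lebesgue_measure]_(y in `[0%R, x]) (f y)%:E)%E].

Definition lipschitz_near_half (R : realType) (q : R -> R) :=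
  exists kappa delta : R, [/\ 0 < kappa, 0 < delta &
    forall s s', s \in `[2^-1 - delta, 2^-1 + delta] ->
      s' \in `[2^-1 - delta, 2^-1 + delta] ->
      `|q s - q s'| <= kappa * `|s - s'|].

Definition majority (R : realType) (d : measure_display)
    (T : measurableType d) (P : probability T R) (V : nat -> {RV P >-> bool})
    (t : nat) : T -> R :=
  \1_[set w | 2^-1 <= t%:R^-1 * (\sum_(i < t) (V i w)%:R : R)].

(* Main.v *)
Require Import Defs.
From HB Require Import structures.
From mathcomp Require Import all_boot all_order all_algebra all_fingroup finmap.
From mathcomp Require Import all_classical all_reals all_analysis.
From mathcomp Require Import measurable_realfun.
From mathcomp Require Import ring lra zify.

Set Implicit Arguments.
Unset Strict Implicit.
Unset Printing Implicit Defensive.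

Import Order.TTheory GRing.Theory Num.Theory.
Import numFieldNormedType.Exports.

Local Open Scope classical_set_scope.
Local Open Scope ring_scope.

(** Write [t = 2m+1]. Given [Theta = x], the sum of the first [t] variables is
    binomial, so [1 - E M_t] is the mean of [Q_m(Theta)], where [Q_m(x)] is the
    probability that a binomial variable of parameters [t], [x] is at most [m].
    The derivative of a binomial tail telescopes ([deriv_binomial_tail]), and
    [- Q_m'] is the polynomial [b_m], the density on [[0, 1]] of the
    Beta(m+1, m+1) law ([deriv_median_tail]). Hence [Q_m(x)] is the integral of
    [b_m] over [[x, 1]] and, exchanging the two integrals
    ([tail_mixture_beta]),

      [1 - E M_t = \int_0^1 b_m(y) F(y) dy = E F(B)]  with [B ~ Beta(m+1, m+1)].

    The law of [B] is symmetric about 1/2, its variance is [1/(4(t+2))] and its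
    fourth central moment is of order [1/t^2]. These moments come from the
    vanishing of the integral of [(u^(k+1) w^(m+1))'], where [u = X - 1/2] and
    [w = X(1-X) = 1/4 - u^2] ([beta_momentS2]).

    It remains to expand [F] at 1/2. If [f(s) = a + b(s-1/2)] up to
    [c|s-1/2|] near 1/2, then [F(y) - F(1/2) = a u + b u^2/2] up to [c u^2/2]
    near 1/2, with [u = y - 1/2] ([local_expansion]). Away from 1/2 the error is
    bounded, hence at most a multiple of [u^4]. Taking the mean at [y = B],
    the term in [a] disappears and [E F(B) = F(1/2) + b/(8t)] up to
    [(c + O(1/t))/t] ([minority_expansion]). The first claim is the case [b = 0]
    with [c] the Lipschitz constant; the second one is the case [b = f'(1/2)],
    where [c] can be chosen arbitrarily small. *)

(** * Binomial tails *)

Section BinomialTail.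
Variable R : realType.
Implicit Types n j k m : nat.

Definition binomial_tail n j : {poly R} :=
  \sum_(k < j.+1) 'C(n, k)%:R *: ('X^k * (1 - 'X) ^+ (n - k)).

(** Each term [C(n,k) X^k (1-X)^(n-k)] differentiates to
    [n (B_(k-1) - B_k)] with [B_k = C(n-1,k) X^k (1-X)^(n-1-k)], so only the
    last [B_j] survives in the sum. *)
Lemma deriv_binomial_tail n j : (j < n)%N ->
  (binomial_tail n j)^`() =
  - ((n * 'C(n.-1, j))%:R *: ('X^j * (1 - 'X) ^+ (n.-1 - j))).
Proof.
have d1X l : ((1 - 'X) ^+ l.+1 : {poly R})^`() = - (l.+1%:R *: (1 - 'X) ^+ l).
  by rewrite deriv_exp derivB derivX derivC sub0r mulN1r scaler_nat mulNrn.
case: n => // n; rewrite /= ltnS.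
elim: j => [|j IH] jn; rewrite /binomial_tail big_ord_recr /=.
  by rewrite big_ord0 add0r !bin0 !subn0 !expr0 !mul1r muln1 scale1r d1X.
rewrite derivD -/(binomial_tail n.+1 j) IH ?(ltnW jn)//.
have -> : (n.+1 - j.+1 = (n - j.+1).+1)%N by lia.
have -> : (n - j = (n - j.+1).+1)%N by lia.
rewrite derivZ derivM derivXn d1X /=.
have e1 : (n.+1 * 'C(n, j) = 'C(n.+1, j.+1) * j.+1)%N.
  by rewrite mul_bin_diag mulnC.
have e2 : (n.+1 * 'C(n, j.+1) = 'C(n.+1, j.+1) * (n - j.+1).+1)%N.
  by rewrite -subSn// [RHS]mulnC -mul_bin_down.
rewrite e1 e2 !natrM -!mul_polyC !polyCM !polyC_natr -mulr_natl.
ring.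
Qed.

Lemma binomial_tail0 n j : (binomial_tail n j).[0] = 1.
Proof.
rewrite /binomial_tail big_ord_recl /= bin0 subn0 expr0 mul1r scale1r.
rewrite hornerD horner_sum big1 ?addr0 => [|i _]; rewrite !hornerE/=.
  by rewrite subr0 expr1n.
by rewrite /bump /= exprS !(mul0r, mulr0).
Qed.

Lemma binomial_tail1 n j : (j < n)%N -> (binomial_tail n j).[1] = 0.
Proof.
move=> jn; rewrite /binomial_tail horner_sum big1 // => i _; rewrite !hornerE/=.
have : (i <= j)%N by rewrite -ltnS.
by move=> ij; rewrite subrr expr0n subn_eq0 leqNgt (leq_ltn_trans ij jn) /= !mulr0.
Qed.

End BinomialTail.

(** * Central moments of the symmetric Beta laws *)

Section PolyIntegral.
Variable R : realType.
Notation mu := (@lebesgue_measure R).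
Implicit Types (p q : {poly R}) (a b : R) (m k : nat).

Lemma integrable_poly a b p :
  mu.-integrable `[a, b] (fun y => (p.[y])%:E).
Proof.
apply: continuous_compact_integrable; first exact: segment_compact.
exact/continuous_subspaceT/continuous_horner.
Qed.

Lemma integral_deriv_poly a b p : a <= b ->
  (\int[mu]_(y in `[a, b]) (p^`().[y])%:E = (p.[b] - p.[a])%:E)%E.
Proof.
rewrite le_eqVlt => /predU1P[->|ab].
  by rewrite subrr set_itv1 integral_set1.
rewrite (@continuous_FTC2 _ _ (horner p))//.
- exact/continuous_subspaceT/continuous_horner.
- split; first by move=> x _; exact: derivable_horner.
  + exact/cvg_at_right_filter/continuous_horner.
  + exact/cvg_at_left_filter/continuous_horner.
- by move=> x _; rewrite -derivE.
Qed.

Definition poly_int p : R := (\int[mu]_(y in `[0, 1]) p.[y])%R.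

Lemma poly_intE p :
  (poly_int p)%:E = (\int[mu]_(y in `[0%R, 1%R]) (p.[y])%:E)%E.
Proof.
by rewrite /poly_int /Rintegral fineK//; exact/integrable_fin_num/integrable_poly.
Qed.

Lemma poly_intD p q : poly_int (p + q) = poly_int p + poly_int q.
Proof.
rewrite /poly_int -RintegralD//; try exact: integrable_poly.
by apply: eq_Rintegral => y _; rewrite hornerD.
Qed.

Lemma poly_intZ (c : R) p : poly_int (c *: p) = c * poly_int p.
Proof.
rewrite /poly_int -RintegralZl//; try exact: integrable_poly.
by apply: eq_Rintegral => y _; rewrite hornerZ.
Qed.

Lemma poly_int_deriv p : poly_int p^`() = p.[1] - p.[0].
Proof.
by apply: EFin_inj; rewrite poly_intE integral_deriv_poly// ler01.
Qed.

(** The density of the Beta(m+1, m+1) law on [[0, 1]]. The form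
    [(2m+1) C(2m, m)] of the normalising constant is the one in which it appears
    as a derivative of a binomial tail. *)
Definition beta_poly m : {poly R} :=
  (m.*2.+1 * 'C(m.*2, m))%:R *: ('X * (1 - 'X)) ^+ m.

Definition beta_moment m k : R :=
  poly_int (beta_poly m * ('X - (2^-1)%:P) ^+ k).

Lemma deriv_median_tail m :
  (binomial_tail R m.*2.+1 m)^`() = - beta_poly m.
Proof.
rewrite deriv_binomial_tail /=; last lia.
by rewrite -[X in (X - m)%N]addnn addnK -exprMn.
Qed.

Lemma beta_poly_ge0 m y : 0 <= y <= 1 -> 0 <= (beta_poly m).[y].
Proof.
move=> /andP[y0 y1]; rewrite /beta_poly !hornerE/= mulr_ge0 ?ler0n//.
by rewrite exprn_ge0// mulr_ge0// subr_ge0.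
Qed.

(** The binomial tail goes from 1 at 0 to 0 at 1, which gives the mass of
    [beta_poly] without evaluating the Beta function. *)
Lemma beta_moment0 m : beta_moment m 0 = 1.
Proof.
rewrite /beta_moment expr0 mulr1 -[beta_poly m]opprK -deriv_median_tail -derivN.
rewrite poly_int_deriv !hornerN binomial_tail0 binomial_tail1 ?opprK ?oppr0 ?add0r//.
lia.
Qed.

Let u : {poly R} := 'X - (2^-1)%:P.
Let w : {poly R} := 'X * (1 - 'X).

Let two_half : 2 * (2^-1)%:P = 1 :> {poly R}.
Proof. by rewrite -(polyC_natr _ 2) -polyCM mulfV ?pnatr_eq0. Qed.

Let wE : w = (4^-1)%:P - u ^+ 2.
Proof.
have -> : (4^-1)%:P = (2^-1)%:P * (2^-1)%:P :> {poly R}.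
  by rewrite -polyCM; congr _%:P; field.
by rewrite /w /u; ring: two_half.
Qed.

Let deriv_u : u^`() = 1.
Proof. by rewrite derivB derivX derivC subr0. Qed.

Let deriv_w : w^`() = - (2 * u).
Proof. by rewrite derivM derivB derivX derivC /u; ring: two_half. Qed.

(** Up to a constant, [u w^m] is the derivative of [w^(m+1)], which vanishes at
    both endpoints. *)
Lemma beta_moment1 m : beta_moment m 1 = 0.
Proof.
pose N : R := (m.*2.+1 * 'C(m.*2, m))%:R.
pose c : R := - N / (2 * m.+1%:R).
have -> : beta_moment m 1 = poly_int (c *: w ^+ m.+1)^`().
  congr poly_int; rewrite derivZ deriv_exp deriv_w expr1 /beta_poly -/w -/N /=.
  rewrite -[_ *+ m.+1]mulr_natr -!mul_polyC -/u -(polyC_natr _ m.+1) -(polyC_natr _ 2).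
  have -> : N%:P = - (c%:P * 2%:P * (m.+1%:R)%:P).
    rewrite -!polyCM -polyCN /c; congr _%:P.
    have : m.+1%:R != 0 :> R by rewrite pnatr_eq0.
    by move: (m.+1%:R) => M M0; field.
  by ring.
by rewrite poly_int_deriv !hornerE/= !exprS; ring.
Qed.

(** Since [w' = - 2 u] and [w = 1/4 - u^2], the derivative of
    [u^(k+1) w^(m+1)] is [(k+1)/4 u^k w^m - (k+2m+3) u^(k+2) w^m]; its integral
    is 0 because [w] vanishes at both endpoints. *)
Lemma beta_momentS2 m k :
  (k + m.*2 + 3)%:R * beta_moment m k.+2 = k.+1%:R / 4 * beta_moment m k.
Proof.
pose c : R := (m.*2.+1 * 'C(m.*2, m))%:R.
have dE : (c *: (u ^+ k.+1 * w ^+ m.+1))^`() =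
    (k.+1%:R / 4) *: (beta_poly m * u ^+ k) +
    (- (k + m.*2 + 3)%:R) *: (beta_poly m * u ^+ k.+2).
  rewrite derivZ derivM !deriv_exp deriv_u deriv_w /= /beta_poly -/c -/w -!mul_polyC.
  rewrite polyCN polyCM !polyC_natr -[_ *+ k.+1]mulr_natr -[_ *+ m.+1]mulr_natr.
  have -> : w ^+ m.+1 = w ^+ m * ((4^-1)%:P - u ^+ 2) by rewrite exprSr {2}wE.
  rewrite !natrD -mul2n natrM !exprS -[k.+1]addn1 -[m.+1]addn1 !natrD.
  ring.
have := poly_int_deriv (c *: (u ^+ k.+1 * w ^+ m.+1)).
rewrite dE poly_intD !poly_intZ -/(beta_moment m k) -/(beta_moment m k.+2).
have w0 : w.[0] = 0 by rewrite hornerM hornerX mul0r.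
have w1 : w.[1] = 0 by rewrite hornerM hornerD hornerN hornerX hornerC subrr mulr0.
rewrite !hornerZ !hornerM ![(w ^+ _).[_]]horner_exp w0 w1 !expr0n/= !mulr0.
lra.
Qed.

Lemma beta_moment2 m : beta_moment m 2 = (4 * (m.*2 + 3)%:R)^-1.
Proof.
have := beta_momentS2 m 0; rewrite beta_moment0 add0n => h.
have m0 : (m.*2 + 3)%:R != 0 :> R by rewrite pnatr_eq0 addn3.
apply: (mulfI m0); rewrite h.
by move: (m.*2 + 3)%:R m0 => M M0; field.
Qed.

Lemma beta_moment4 m :
  beta_moment m 4 = 3 / (16 * (m.*2 + 3)%:R * (m.*2 + 5)%:R).
Proof.
have := beta_momentS2 m 2; rewrite beta_moment2 -addnA addnC -addnA => h.
have m3 : (m.*2 + 3)%:R != 0 :> R by rewrite pnatr_eq0 addn3.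
have m5 : (m.*2 + 5)%:R != 0 :> R by rewrite pnatr_eq0 addnC.
apply: (mulfI m5); rewrite h.
by move: (m.*2 + 3)%:R (m.*2 + 5)%:R m3 m5 => M N M0 N0; field; rewrite M0 N0.
Qed.

End PolyIntegral.

(** * The law of the number of ones *)

Section MinorityProbability.
Variables (R : realType) (d : measure_display) (T : measurableType d).
Variables (P : probability T R) (V : nat -> {RV P >-> bool}).
Variable Theta : {RV P >-> R}.
Hypothesis Theta01 : forall w, 0 <= Theta w <= 1.
Hypothesis condV : cond_iid_bernoulli V Theta.

Lemma measurable_poly_Theta (p : {poly R}) :
  measurable_fun [set: T] (fun w => p.[Theta w]).
Proof. by apply: measurableT_comp => //; exact: measurable_poly. Qed.

(** Polynomials are unbounded on the line but bounded on [[0, 1]], where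
    [Theta] lives; hence the integrals below are taken over the probability
    space rather than against the law of [Theta]. *)
Lemma integrable_poly_Theta (p : {poly R}) :
  P.-integrable [set: T] (fun w => (p.[Theta w])%:E).
Proof.
apply: measurable_bounded_integrable => //.
- by rewrite ltey_eq fin_num_measure.
- exact: measurable_poly_Theta.
- have := @segment_compact R 0 1.
  move=> /(continuous_compact (continuous_subspaceT (@continuous_horner _ p))).
  move=> /compact_bounded [M [Mr hM]]; exists M; split => // x Mx w _ /=.
  apply: (hM x Mx); exists (Theta w) => //=.
  by rewrite in_itv /= Theta01.
Qed.

Definition heads_event t (A : {set 'I_t}) : set T :=
  [set w | [set i : 'I_t | V i w]%SET = A].

Lemma prob_heads_event t (A : {set 'I_t}) :
  measurable (heads_event A) /\
  P (heads_event A) =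
    (\int[P]_w (('X^#|A| * (1 - 'X) ^+ (t - #|A|)).[Theta w])%:E)%E.
Proof.
pose v (n : nat) : bool := if insub n is Some i then i \in A else false.
pose J := [fset i | i in iota 0 t]%fset.
have memJ n : (n \in J) = (n < t)%N by rewrite !inE /= mem_iota.
have vE (i : 'I_t) : v i = (i \in A) by rewrite /v valK.
have evE : heads_event A = \bigcap_(i in [set` J]) (V i @^-1` [set v i]).
  apply/seteqP; split => w /=.
    move=> hA i /=; rewrite memJ => it.
    by rewrite -[i]/(val (Ordinal it)) vE -hA inE.
  move=> h; apply/setP => i; rewrite inE -vE.
  by apply: h => /=; rewrite memJ.
have [_ /(_ setT measurableT)] := condV J v.
rewrite preimage_setT setIT -evE => PE; split.
  rewrite evE; apply: fin_bigcap_measurable => // i _.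
  exact: measurable_funPTI.
rewrite PE.
have pE (x : R) : \prod_(i <- J) bernoulli_pmf x (v i) =
    ('X^#|A| * (1 - 'X) ^+ (t - #|A|)).[x].
  have -> : \prod_(i <- J) bernoulli_pmf x (v i) =
      \prod_(i <- iota 0 t) bernoulli_pmf x (v i).
    apply: perm_big; apply: uniq_perm; rewrite ?iota_uniq ?fset_uniq//.
    by move=> i; rewrite memJ mem_iota.
  rewrite -[t in iota 0 t]subn0 big_mkord.
  rewrite (bigID (fun i => i \in A)) /=.
  rewrite (eq_bigr (fun=> x)); last by move=> i iA; rewrite vE iA.
  rewrite [X in _ * X](eq_bigr (fun=> 1 - x)); last first.
    by move=> i iA; rewrite vE (negbTE iA).
  by rewrite !prodr_const !hornerE -[X in (X - _)%N]card_ord -(cardC A) addKn.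
under eq_integral do rewrite pE.
rewrite integral_distribution//.
  by apply/measurable_EFinP; exact: measurable_poly.
exact: integrable_poly_Theta.
Qed.

(** Summing [prob_heads_event] over the subsets of [{0, .., t-1}] of each size
    [k <= j] produces the binomial coefficients. *)
Lemma prob_few_heads t j :
  P [set w | (\sum_(i < t) V i w <= j)%N] =
  (\int[P]_w ((binomial_tail R t j).[Theta w])%:E)%E.
Proof.
pose D := [seq A : {set 'I_t} <- index_enum _ | (#|A| <= j)%N].
have -> : [set w | (\sum_(i < t) V i w <= j)%N] =
    \bigcup_(A in [set` D]) heads_event A.
  have sE w : (\sum_(i < t) V i w = #|[set i : 'I_t | V i w]%SET|)%N.
    by rewrite -sum1dep_card [RHS]big_mkcond /=; apply: eq_bigr => i _; case: (V i w).
  apply/seteqP; split => w /=.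
    rewrite sE => h; exists [set i : 'I_t | V i w]%SET => //=.
    by rewrite mem_filter h mem_index_enum.
  by move=> [A /=]; rewrite mem_filter sE => /andP[h _] ->.
rewrite measure_fin_bigcup//; last 2 first.
- by move=> A B _ _ [w [/= <- <-]].
- by move=> A _; case: (prob_heads_event A).
rewrite -fsbig_seq ?filter_uniq ?index_enum_uniq//.
rewrite (eq_bigr (fun A : {set 'I_t} => 
  (\int[P]_w (('X^#|A| * (1 - 'X) ^+ (t - #|A|)).[Theta w])%:E)%E)); last first.
  by move=> A _; case: (prob_heads_event A).
rewrite -integral_sum//; last by move=> A; exact: integrable_poly_Theta.
apply: eq_integral => w _; rewrite sumEFin; congr (_%:E).
rewrite big_filter /= -horner_sum; congr (_.[_]).
rewrite (partition_big (fun A : {set 'I_t} => inord #|A| : 'I_j.+1) xpredT)//=.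
apply: eq_bigr => k _.
rewrite (eq_bigl (fun A : {set 'I_t} => #|A| == k)); last first.
  move=> A /=; apply/andP/eqP => [[Aj /eqP <-]|Ak]; first by rewrite inordK.
  by rewrite Ak -ltnS ltn_ord; split => //; apply/eqP/val_inj; rewrite /= inordK.
rewrite (eq_bigr (fun=> 'X^k * (1 - 'X) ^+ (t - k))); last by move=> A /eqP ->.
rewrite sumr_const scaler_nat; congr (_ *+ _).
have := card_draws 'I_t k; rewrite card_ord => <-.
by apply: eq_card => A; rewrite !inE.
Qed.

End MinorityProbability.

(** * From the mixture to the Beta law *)

Section BetaMixture.
Variables (R : realType) (d : measure_display) (T : measurableType d).
Variables (P : probability T R) (Theta : {RV P >-> R}) (F : R -> R).
Hypothesis Theta01 : forall w, 0 <= Theta w <= 1.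
Hypothesis cdfF : forall x, (F x)%:E = cdf Theta x.
Notation mu := (@lebesgue_measure R).

Lemma cdf_fun01 y : 0 <= F y <= 1.
Proof. by rewrite -!lee_fin cdfF cdf_ge0 cdf_le1. Qed.

Lemma measurable_cdf_fun : measurable_fun [set: R] F.
Proof.
apply/measurable_EFinP.
have -> : EFin \o F = cdf Theta by apply/funext => x /=.
exact: cdf_measurable.
Qed.

Lemma integrable_beta_cdf m :
  mu.-integrable `[0, 1] (fun y => ((beta_poly R m).[y] * F y)%:E).
Proof.
apply: (le_integrable _ _ _ (integrable_poly 0 1 (beta_poly R m))) => //.
  apply/measurable_EFinP; apply: measurable_funM.
    exact: measurable_poly.
  apply: measurable_funTS. exact: measurable_cdf_fun.
move=> y y01; rewrite /= lee_fin normrM ler_piMr//.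
by have /andP[F0 F1] := cdf_fun01 y; rewrite ger0_norm.
Qed.

(** Both sides are the integral of [b_m(y) 1_(Theta <= y)] over the product of
    the probability space with [[0, 1]]: integrating in [y] first gives the
    binomial tail at [Theta], integrating over the probability space first
    gives [b_m F]. *)
Lemma tail_mixture_beta m :
  (\int[P]_w ((binomial_tail R m.*2.+1 m).[Theta w])%:E =
   \int[mu]_(y in `[0%R, 1%R]) ((beta_poly R m).[y] * F y)%:E)%E.
Proof.
pose b (y : R) := (beta_poly R m).[y] * \1_(`[0, 1] : set R) y.
have b0 y : 0 <= b y.
  rewrite /b indicE; have [|_] := boolP (y \in _); last by rewrite mulr0.
  by rewrite inE /= in_itv /= mulr1 => /beta_poly_ge0.
have mb : measurable_fun [set: R] b.
  apply: measurable_funM; first exact: measurable_poly.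
  exact: measurable_indic.
pose U : set (T * measurableTypeR R) := [set z | Theta z.1 <= z.2].
have UE w y : ((w, y) \in U) = (Theta w <= y).
  by apply/idP/idP; rewrite in_setE.
have mU : measurable U.
  have : measurable_fun [set: T * measurableTypeR R]
      (fun z => Theta z.1 <= z.2).
    apply: measurable_fun_ler => //.
    exact: measurableT_comp.
  by move=> /(_ measurableT [set true]); rewrite setTI; exact.
pose g (z : T * measurableTypeR R) := (b z.2 * \1_U z)%:E.
transitivity (\int[P]_w \int[mu]_y g (w, y))%E.
  apply: eq_integral => w _.
  have /andP[T0 T1] := Theta01 w.
  transitivity (\int[mu]_(y in `[Theta w, 1%R]) ((beta_poly R m).[y])%:E)%E.
    rewrite -[beta_poly R m]opprK -deriv_median_tail -derivN.
    rewrite integral_deriv_poly// !hornerN binomial_tail1 ?oppr0 ?add0r ?opprK//.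
    lia.
  rewrite integral_mkcond; apply: eq_integral => y _.
  rewrite patchE /g /b !indicE /= UE !mem_setE !in_itv /=.
  have [Ty|Ty] /= := leP (Theta w) y; last by rewrite mulr0.
  by rewrite (le_trans T0 Ty) /= mulr1; case: (y <= 1); rewrite ?mulr1 ?mulr0.
rewrite fubini_tonelli//; first last.
- by move=> z; rewrite lee_fin mulr_ge0.
- apply/measurable_EFinP; apply: measurable_funM.
    exact: measurableT_comp.
  exact: measurable_indic.
rewrite [RHS]integral_mkcond; apply: eq_integral => y _.
transitivity ((b y)%:E * \int[P]_w (\1_(Theta @^-1` `]-oo, y]) w)%:E)%E.
  rewrite -ge0_integralZl_EFin//.
  apply/measurable_EFinP; apply: measurable_indic.
  exact: measurable_funPTI.
rewrite integral_indic//; last first.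
  exact: measurable_funPTI.
transitivity ((b y)%:E * (F y)%:E)%E; first by rewrite setIT cdfF.
rewrite -EFinM patchE /b indicE.
by case: (_ \in _); rewrite ?mulr1// mulr0 mul0r.
Qed.

End BetaMixture.

Section Majority.
Variables (R : realType) (d : measure_display) (T : measurableType d).
Variables (P : probability T R) (V : nat -> {RV P >-> bool}).

(** For odd [t] there is no tie, and the complement of a majority is a sum of at
    most [m]. *)
Lemma minority_probE m :
  (1 - fine 'E_P[majority V m.*2.+1])%:E =
  P [set w | (\sum_(i < m.*2.+1) V i w <= m)%N].
Proof.
set t := m.*2.+1; set A := [set w | _].
have -> : majority V t = \1_(~` A).
  rewrite /majority; congr (\1_ _); apply/seteqP; split => w /=;
    rewrite -natr_sum ler_pdivlMl ?ltr0n// ler_pdivrMr ?ltr0n// -natrM ler_nat /t /A /=;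
    move: (\sum_(i < _) _)%N => S; [move=> ? /=|move/negP]; lia.
have mA : measurable A.
  have mS : measurable_fun [set: T] (fun w => \sum_(i < t) (V i w)%:R : R).
    apply: measurable_sum => i.
    apply: (@measurableT_comp _ _ _ _ _ _ (fun c : bool => c%:R : R)).
      by move=> _ Y mY.
    exact: measurable_funPT.
  have : measurable_fun [set: T] (fun w => \sum_(i < t) (V i w)%:R <= m%:R :> R).
    exact: measurable_fun_ler.
  move=> /(_ measurableT [set true]); rewrite setTI => /(_ I).
  rewrite (_ : _ @^-1` _ = A)//; apply/seteqP; split => w /=.
    by rewrite -natr_sum ler_nat.
  by rewrite -natr_sum ler_nat.
rewrite expectation_indic; last exact: measurableC.
rewrite probability_setC// fineB ?fin_num_measure//= subKr fineK//.
by rewrite fin_num_measure.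
Qed.
End Majority.

(** * Expansion of the distribution function at 1/2 *)

Section LocalExpansion.
Variables (R : realType) (F f : R -> R).
Hypothesis densF : has_density01 F f.
Notation mu := (@lebesgue_measure R).

Lemma integrable_density : mu.-integrable `[0, 1] (EFin \o f).
Proof.
have [mf f0 FE] := densF.
apply/integrableP; split; first exact/measurable_EFinP.
under eq_integral.
  move=> x x01 /=.
  rewrite ger0_norm; last by apply: f0; move: x01; rewrite mem_setE.
  over.
by rewrite -FE ?ltry// in_itv /= ler01 lexx.
Qed.

Lemma cdf_increment (x y : R) : 0 <= x -> x <= y -> y <= 1 ->
  F y - F x = (\int[mu]_(s in `]x, y]) f s)%R.
Proof.
move=> x0 xy y1; have [mf f0 FE] := densF.
have FR z : 0 <= z <= 1 -> F z = (\int[mu]_(s in `[0, z]) f s)%R.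
  by move=> z01; rewrite /Rintegral -FE ?in_itv.
rewrite !FR ?(le_trans x0 xy) ?y1 ?x0 ?(le_trans xy y1)//.
rewrite Rintegral_itvB//.
apply: integrableS integrable_density => //.
by apply: subset_itvl; rewrite bnd_simp.
Qed.

Lemma integrable_density_itv (x y : R) : 0 <= x -> y <= 1 ->
  mu.-integrable `]x, y] (EFin \o f).
Proof.
move=> x0 y1; apply: integrableS integrable_density => //.
by apply: subset_itv; rewrite bnd_simp.
Qed.

Lemma integrable_poly_itv (x y : R) (q : {poly R}) :
  mu.-integrable `]x, y] (EFin \o horner q).
Proof.
apply: integrableS (integrable_poly x y q) => //.
by apply: subset_itv; rewrite bnd_simp.
Qed.

Lemma Rintegral_deriv_poly (x y : R) (q : {poly R}) : x <= y ->
  (\int[mu]_(s in `]x, y]) q^`().[s])%R = q.[y] - q.[x].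
Proof.
move=> xy; rewrite /Rintegral integral_itv_obnd_cbnd.
  by rewrite integral_deriv_poly.
by apply/measurable_EFinP; exact: measurable_poly.
Qed.

(** Comparing the density with the derivative of a polynomial reduces the
    estimates of [F] to polynomial identities. *)
Lemma cdf_increment_le (x y : R) (q : {poly R}) : 0 <= x -> x <= y -> y <= 1 ->
  (forall s, x <= s <= y -> f s <= q^`().[s]) -> F y - F x <= q.[y] - q.[x].
Proof.
move=> x0 xy y1 fq; rewrite cdf_increment// -Rintegral_deriv_poly//.
apply: le_Rintegral => //.
- exact: integrable_density_itv.
- exact: integrable_poly_itv.
by move=> s /=; rewrite in_itv /= => /andP[/ltW xs sy]; rewrite fq// xs.
Qed.

Lemma cdf_increment_ge (x y : R) (q : {poly R}) : 0 <= x -> x <= y -> y <= 1 ->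
  (forall s, x <= s <= y -> q^`().[s] <= f s) -> q.[y] - q.[x] <= F y - F x.
Proof.
move=> x0 xy y1 fq; rewrite cdf_increment// -Rintegral_deriv_poly//.
apply: le_Rintegral => //.
- exact: integrable_poly_itv.
- exact: integrable_density_itv.
by move=> s /=; rewrite in_itv /= => /andP[/ltW xs sy]; rewrite fq// xs.
Qed.

Definition quad_poly (a e : R) : {poly R} :=
  a *: ('X - (2^-1)%:P) + (e / 2) *: ('X - (2^-1)%:P) ^+ 2.

Lemma horner_quad a e y :
  (quad_poly a e).[y] = a * (y - 2^-1) + e / 2 * (y - 2^-1) ^+ 2.
Proof.
by rewrite /quad_poly hornerD !hornerZ horner_exp hornerD hornerN hornerX hornerC.
Qed.

Lemma deriv_quad a e y : (quad_poly a e)^`().[y] = a + e * (y - 2^-1).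
Proof.
rewrite /quad_poly derivD !derivZ deriv_exp derivB derivX derivC subr0 /=.
rewrite hornerD !hornerZ hornerMn mul1r hornerD hornerN hornerX !hornerC mulr1.
by field.
Qed.

(** On each side of 1/2 the density lies between the two affine functions
    [a + (b - c)(s - 1/2)] and [a + (b + c)(s - 1/2)], in an order that depends
    on the side; integrating from 1/2 bounds the error by [c/2] times the
    square. *)
Lemma local_expansion (a b c eta : R) : 0 < eta -> eta <= 2^-1 ->
  (forall s, `|s - 2^-1| <= eta ->
    `|f s - (a + b * (s - 2^-1))| <= c * `|s - 2^-1|) ->
  forall y, `|y - 2^-1| <= eta ->
  `|F y - F 2^-1 - (a * (y - 2^-1) + b / 2 * (y - 2^-1) ^+ 2)| <=
    c / 2 * (y - 2^-1) ^+ 2.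
Proof.
move=> eta0 eta2 hf y; rewrite ler_norml => /andP[y1 y2].
have [hy|/ltW hy] := leP 2^-1 y.
  have hs s : 2^-1 <= s <= y ->
      (quad_poly a (b - c))^`().[s] <= f s <= (quad_poly a (b + c))^`().[s].
    move=> /andP[s1 s2]; rewrite !deriv_quad.
    have := hf s; rewrite ger0_norm ?subr_ge0// => /(_ _).
    rewrite ler_norml => /(_ _)/andP[|h1 h2]; first lra.
    apply/andP; split; lra.
  have up : F y - F 2^-1 <= (quad_poly a (b + c)).[y] - (quad_poly a (b + c)).[2^-1].
    by apply: cdf_increment_le => //; [lra..|move=> s /hs /andP[]].
  have lo : (quad_poly a (b - c)).[y] - (quad_poly a (b - c)).[2^-1] <= F y - F 2^-1.
    by apply: cdf_increment_ge => //; [lra..|move=> s /hs /andP[]].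
  move: up lo; rewrite !horner_quad subrr expr0n /= !mulr0 !addr0 !subr0 => up lo.
  by rewrite ler_norml; apply/andP; split; lra.
have hs s : y <= s <= 2^-1 ->
    (quad_poly a (b + c))^`().[s] <= f s <= (quad_poly a (b - c))^`().[s].
  move=> /andP[s1 s2]; rewrite !deriv_quad.
  have := hf s; rewrite ler0_norm ?subr_le0// => /(_ _).
  rewrite ler_norml => /(_ _)/andP[|h1 h2]; first lra.
  apply/andP; split; lra.
have up : F 2^-1 - F y <= (quad_poly a (b - c)).[2^-1] - (quad_poly a (b - c)).[y].
  by apply: cdf_increment_le => //; [lra..|move=> s /hs /andP[]].
have lo : (quad_poly a (b + c)).[2^-1] - (quad_poly a (b + c)).[y] <= F 2^-1 - F y.
  by apply: cdf_increment_ge => //; [lra..|move=> s /hs /andP[]].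
move: up lo; rewrite !horner_quad subrr expr0n /= !mulr0 !addr0 !sub0r => up lo.
by rewrite ler_norml; apply/andP; split; lra.
Qed.

End LocalExpansion.

(** * Asymptotics of the minority probability *)

Section Assembly.
Variables (R : realType) (d : measure_display) (T : measurableType d).
Variables (P : probability T R) (V : nat -> {RV P >-> bool}) (F f : R -> R).
Hypothesis mixF : is_mixture_cdf V F.
Hypothesis densF : has_density01 F f.
Notation mu := (@lebesgue_measure R).

Lemma mixture_cdf01 y : 0 <= F y <= 1.
Proof. by have [X [_ _ cdfF]] := mixF; exact: (cdf_fun01 cdfF). Qed.

(** [E M_t] enters only through the mean of [F] under the Beta law, so that
    polynomial bounds on [F] over [[0, 1]] pass to the mean. *)
Lemma minority_beta_approx m (q r : {poly R}) :
  (forall y, 0 <= y <= 1 -> `|F y - q.[y]| <= r.[y]) ->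
  `|1 - fine 'E_P[majority V m.*2.+1] - poly_int (beta_poly R m * q)| <=
    poly_int (beta_poly R m * r).
Proof.
have [X [T01 condV cdfF]] := mixF; move=> Fqr.
have -> : 1 - fine 'E_P[majority V m.*2.+1] =
    (\int[mu]_(y in `[0, 1]) ((beta_poly R m).[y] * F y))%R.
  apply: EFin_inj; rewrite minority_probE (prob_few_heads T01 condV).
  rewrite (tail_mixture_beta T01 cdfF) /Rintegral fineK//.
  exact/integrable_fin_num/(integrable_beta_cdf cdfF).
have iF := integrable_beta_cdf cdfF m.
have iq := integrable_poly 0 1 (beta_poly R m * q).
have iFq : mu.-integrable `[0, 1] (fun y =>
    ((beta_poly R m).[y] * F y)%:E - ((beta_poly R m * q).[y])%:E)%E.
  by apply: integrableB.
rewrite -RintegralB//.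
apply: le_trans (le_normr_Rintegral _ iFq) _ => //.
apply: le_Rintegral => //.
- exact: (integrable_norm iFq).
- exact: integrable_poly.
move=> y; rewrite /= in_itv /= => y01.
rewrite !hornerM -mulrBr normrM ger0_norm ?beta_poly_ge0//.
by apply: ler_wpM2l; [exact: beta_poly_ge0|exact: Fqr].
Qed.

(** The points within [eta] of 1/2 contribute at most [c] times the variance of
    the Beta law. The points further away are controlled by its fourth moment,
    which has one more factor [1/t]: their share goes into [C]. *)
Lemma minority_expansion (a b c eta : R) :
  0 <= c -> 0 < eta -> eta <= 2^-1 ->
  (forall s, `|s - 2^-1| <= eta ->
    `|f s - (a + b * (s - 2^-1))| <= c * `|s - 2^-1|) ->
  exists2 C, 0 <= C & forall t, odd t ->
  `|1 - fine 'E_P[majority V t] - (F 2^-1 + (8 * t%:R)^-1 * b)| <=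
    (c + C / t%:R) * t%:R^-1.
Proof.
move=> c0 eta0 eta2 hf.
(* For y in [0, 1], |F y - F(1/2)| <= 1 and |y - 1/2| <= 1, so the error of the
   expansion is at most 1 + |a| + |b|; dividing by eta^4 makes it at most
   C (y - 1/2)^4 when |y - 1/2| >= eta. *)
pose C := (1 + `|a| + `|b|) / eta ^+ 4.
have C0 : 0 <= C by rewrite /C divr_ge0// exprn_ge0// ltW.
(* The summand |b| pays for replacing t + 2 by t in the main term. *)
exists (C + `|b|); first by rewrite addr_ge0.
move=> t ot; pose m := t./2.
have tE : t = m.*2.+1 by rewrite /m -[LHS]odd_double_half ot.
pose u : {poly R} := 'X - (2^-1)%:P.
have uE y : u.[y] = y - 2^-1 by rewrite hornerD hornerN hornerX hornerC.
pose q := F 2^-1 *: u ^+ 0 + (a *: u ^+ 1 + (b / 2) *: u ^+ 2).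
pose r := (c / 2) *: u ^+ 2 + C *: u ^+ 4.
have qE y : q.[y] = F 2^-1 + (a * (y - 2^-1) + b / 2 * (y - 2^-1) ^+ 2).
  by rewrite !hornerD !hornerZ !horner_exp uE expr0 expr1 mulr1.
have rE y : r.[y] = c / 2 * (y - 2^-1) ^+ 2 + C * (y - 2^-1) ^+ 4.
  by rewrite !hornerD !hornerZ !horner_exp uE.
have Fqr y : 0 <= y <= 1 -> `|F y - q.[y]| <= r.[y].
  move=> /andP[y0 y1]; rewrite qE rE opprD addrA.
  have [hy|hy] := leP `|y - 2^-1| eta.
    apply: le_trans (local_expansion densF eta0 eta2 hf hy) _.
    by rewrite lerDl mulr_ge0// exprn_even_ge0.
  have u1 : `|y - 2^-1| <= 1 by rewrite ler_norml; apply/andP; split; lra.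
  apply: (@le_trans _ _ (1 + `|a| + `|b|)).
    apply: le_trans (ler_normB _ _) _; rewrite -addrA; apply: lerD.
      have /andP[? ?] := mixture_cdf01 y; have /andP[? ?] := mixture_cdf01 2^-1.
      by rewrite ler_norml; apply/andP; split; lra.
    apply: le_trans (ler_normD _ _) _; apply: lerD; rewrite normrM.
      by rewrite ler_piMr.
    rewrite -[leRHS]mulr1 ler_pM ?normr_ge0//.
      by rewrite normrM ler_piMr// ger0_norm; lra.
    by rewrite normrX exprn_ile1.
  have e4 : eta ^+ 4 <= (y - 2^-1) ^+ 4.
    rewrite -[leRHS]ger0_norm ?exprn_even_ge0// normrX.
    by rewrite lerXn2r ?nnegrE// ltW.
  apply: (@le_trans _ _ (C * (y - 2^-1) ^+ 4)).
    by rewrite /C mulrAC ler_pdivlMr ?exprn_gt0// ler_wpM2l// !addr_ge0.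
  by rewrite lerDr mulr_ge0 ?divr_ge0// exprn_even_ge0.
have := minority_beta_approx m Fqr.
rewrite /q /r !mulrDr -!scalerAr !poly_intD !poly_intZ.
rewrite -!/(beta_moment R m _) beta_moment0 beta_moment1 beta_moment2 beta_moment4.
rewrite -tE.
have -> : (m.*2 + 3)%:R = t%:R + 2 :> R by rewrite -natrD tE; congr _%:R; lia.
have -> : (m.*2 + 5)%:R = t%:R + 4 :> R by rewrite -natrD tE; congr _%:R; lia.
have t1 : 1 <= t%:R :> R by rewrite ler1n tE.
move: (t%:R) (fine _) t1 => x e x1; rewrite mulr1 mulr0 add0r => h.
have x0 : 0 < x by lra.
pose i := x^-1; pose j := (x + 2)^-1; pose k := (x + 4)^-1.
have i0 : 0 < i by rewrite invr_gt0.
have j0 : 0 < j by rewrite invr_gt0; lra.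
have k0 : 0 < k by rewrite invr_gt0; lra.
have ji : j <= i by rewrite lef_pV2 ?posrE; lra.
have ki : k <= i by rewrite lef_pV2 ?posrE; lra.
have ij : i - j = 2 * (i * j).
  by rewrite /i /j; field; rewrite !gt_eqF//; lra.
have e2 : (4 * (x + 2))^-1 = 4^-1 * j by rewrite invfM.
have e4 : 3 / (16 * (x + 2) * (x + 4)) = 3 / 16 * (j * k).
  by rewrite !invfM !mulrA.
have e8 : (8 * x)^-1 = 8^-1 * i by rewrite invfM.
rewrite e8 -/i; rewrite e2 e4 in h.
have ii : i * j <= i * i by rewrite ler_wpM2l // ltW.
have jk : j * k <= i * i by apply: ler_pM => //; exact: ltW.
have -> : 1 - e - (F 2^-1 + 8^-1 * i * b) =
  (1 - e - (F 2^-1 + b / 2 * (4^-1 * j))) - b / 4 * (i * j).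
  have ib : i * b = j * b + 2 * (i * j) * b by rewrite -ij; ring.
  by rewrite -(mulrA _ i b) ib; field.
apply: le_trans (ler_normB _ _) _.
have hb : `|b / 4 * (i * j)| <= `|b| * (i * i).
  have ij0 : 0 <= i * j by rewrite mulr_ge0// ltW.
  rewrite normrM (ger0_norm ij0); apply: ler_pM => //.
  by rewrite normrM ler_piMr// ger0_norm; lra.
have hC : C * (3 / 16 * (j * k)) <= C * (i * i).
  by apply: ler_wpM2l => //; have : 0 < j * k by [rewrite mulr_gt0]; lra.
have hc : c / 2 * (4^-1 * j) <= c * i.
  have : c * j <= c * i by apply: ler_wpM2l.
  have : 0 <= c * j by rewrite mulr_ge0// ltW.
  by lra.
have -> : (c + (C + `|b|) * i) * i = c * i + C * (i * i) + `|b| * (i * i) by ring.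
by apply: lerD => //; apply: le_trans h _; exact: lerD.
Qed.
End Assembly.

Lemma lipschitz_error_half (R : realType) (f : R -> R) :
  lipschitz_near_half f -> exists c eta : R, [/\ 0 <= c, 0 < eta, eta <= 2^-1 &
    forall s, `|s - 2^-1| <= eta ->
      `|f s - (f 2^-1 + 0 * (s - 2^-1))| <= c * `|s - 2^-1|].
Proof.
move=> [kappa [delta [k0 d0 hl]]].
(* The bound 1/2 on the radius keeps the neighbourhood inside [0, 1], the only
   place where the density determines the distribution function. *)
exists kappa, (Num.min delta 2^-1); split.
- exact: ltW.
- by rewrite lt_min d0 invr_gt0 ltr0n.
- by rewrite ge_min lexx orbT.
move=> s; rewrite le_min => /andP[]; rewrite ler_norml => /andP[s1 s2] _.
rewrite mul0r addr0; apply: hl; rewrite in_itv /=; apply/andP; split; lra.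
Qed.

Lemma derivable_error_half (R : realType) (f : R -> R) :
  derivable f 2^-1 1 -> forall c, 0 < c -> exists2 eta : R,
    0 < eta <= 2^-1 &
    forall s, `|s - 2^-1| <= eta ->
      `|f s - (f 2^-1 + derive1 f 2^-1 * (s - 2^-1))| <= c * `|s - 2^-1|.
Proof.
move=> df c c0.
have : (fun h : R => h^-1 *: (f (h + 2^-1) - f 2^-1)) @ 0^' --> derive1 f 2^-1.
  rewrite derive1E.
  under eq_fun => h do rewrite -[X in f (X + _)](mulr1 h).
  exact: df.
move=> /cvgrPdist_le /(_ c c0).
rewrite /prop_near1 /nbhs /= /dnbhs /within /= => /nbhs_ballP[e /= e0 he].
exists (Num.min (e / 2) 2^-1).
  by rewrite lt_min divr_gt0 ?ge_min ?lexx ?orbT ?invr_gt0 ?ltr0n.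
move=> s; rewrite le_min => /andP[se _].
have [->|s2] := eqVneq s 2^-1; first by rewrite subrr mulr0 addr0 subrr !normr0 mulr0.
have s0 : s - 2^-1 != 0 by rewrite subr_eq0.
have := he (s - 2^-1); rewrite /ball /= sub0r normrN subrK => /(_ _ s0) h.
have {h} : `|f^`()%classic 2^-1 - (s - 2^-1)^-1 *: (f s - f 2^-1)| <= c.
  by apply: h; apply: le_lt_trans se _; rewrite ltr_pdivrMr// ltr_pMr//; lra.
rewrite distrC -(ler_pM2r (_ : 0 < `|s - 2^-1|)) ?normr_gt0// -normrM.
by rewrite mulrBl -[_ *: _]/(_ * _) mulrAC mulVf// mul1r opprD addrA.
Qed.

Theorem corollary1 (R : realType) (d : measure_display) (T : measurableType d)
    (P : probability T R) (V : nat -> {RV P >-> bool}) (F f : R -> R)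
    (hV : exchangeable V) (hF : is_mixture_cdf V F)
    (hf : has_density01 F f) (hlip : lipschitz_near_half f) :
  (fun t : nat => 1 - fine 'E_P[majority V t])%R =
    (fun=> F 2^-1)%R +O_ (within [set t | odd t] \oo) (fun t => t%:R^-1 : R)
  /\
  (derivable f 2^-1 1 ->
   (fun t : nat => 1 - fine 'E_P[majority V t])%R =
     (fun t => F 2^-1 + (8 * t%:R)^-1 * derive1 f 2^-1)%R
       +o_ (within [set t | odd t] \oo) (fun t => t%:R^-1 : R)).
Proof.
split.
  have [c [eta [c0 eta0 eta2 he]]] := lipschitz_error_half hlip.
  have [C C0 hC] := minority_expansion hF hf c0 eta0 eta2 he.
  apply/eqaddOP; exists (c + C); split; first exact: num_real.
  move=> k /ltW hk; rewrite near_withinE; exists 1%N => // t /= t1 ot.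
  have t0 : 1 <= t%:R :> R by rewrite ler1n.
  have := hC _ ot; rewrite mulr0 addr0 => h.
  rewrite [leLHS](_ : _ = `|1 - fine 'E_P[majority V t] - F 2^-1|)//.
  apply: le_trans h _; rewrite (@ger0_norm _ t%:R^-1) ?invr_ge0 ?ler0n//.
  rewrite ler_wpM2r ?invr_ge0 ?ler0n//; apply: le_trans hk.
  by rewrite lerD2l ler_piMr// invf_le1// (lt_le_trans ltr01).
move=> df; apply/eqaddoP => eps eps0.
have e2 : 0 < eps / 2 by rewrite divr_gt0.
have [eta /andP[eta0 eta2] he] := derivable_error_half df e2.
have [C C0 hC] := minority_expansion hF hf (ltW e2) eta0 eta2 he.
rewrite near_withinE; exists (Num.truncn (C / (eps / 2))).+1 => // t /= tN ot.
have t0 : 0 < t%:R :> R by rewrite ltr0n (leq_trans _ tN).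
have tC : C / (eps / 2) <= t%:R.
  by apply/ltW/(lt_le_trans (truncnS_gt _)); rewrite ler_nat.
rewrite [leLHS](_ : _ = `|1 - fine 'E_P[majority V t]
   - (F 2^-1 + (8 * t%:R)^-1 * derive1 f 2^-1)|)//.
apply: le_trans (hC _ ot) _; rewrite (@ger0_norm _ t%:R^-1) ?invr_ge0 ?ler0n//.
rewrite ler_wpM2r ?invr_ge0 ?ler0n//.
have : C / t%:R <= eps / 2 by rewrite ler_pdivrMr// mulrC -ler_pdivrMr.
lra.
Qed.
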